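(* Let $G$ be a totally disconnected locally compact second countable topological group and let $g\in G$ be such that the closure $\mathrm{cl}(\langle g\rangle)$ of the cyclic subgroup generated by $g$ is compact. Write $g^G:=\{hgh^{-1}\mid h\in G\}$. The following are equivalent: (1) $g^G$ is open in $G$. (2) $g^G$ is non-meagre in $G$. (3) $g^G$ is non-null with respect to the Haar measure on $G$.
   Context: All topological groups are assumed to be Hausdorff. The Haar measure is the left-invariant Haar measure on $G$ (unique up to positive constant multiples); a set is non-null if it does not have Haar measure zero. A subset is meagre if it is a countable union of nowhere dense sets, and non-meagre otherwise. *)

(* Defs.v *)
From HB Require Import structures.
From mathcomp Require Import all_boot all_order all_algebra.
From mathcomp Require Import all_classical all_reals all_analysis.

Set Implicit Arguments.
Unset Strict Implicit.
Unset Printing Implicit Defensive.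

Local Open Scope classical_set_scope.
Local Open Scope ring_scope.

HB.structure Definition PreTopologicalGroup :=
  {G of Topological G & Group G}.

HB.mixin Record PreTopologicalGroup_isTopologicalGroup G
    of PreTopologicalGroup G := {
  mulg_continuous : continuous (fun x : G * G => (x.1 * x.2)%g) ;
  invg_continuous : continuous (fun x : G => (x^-1)%g) ;
}.

(* Not assumed to be Hausdorff. *)
#[short(type="topologicalGroupType")]
HB.structure Definition TopologicalGroup :=
  {G of PreTopologicalGroup G & PreTopologicalGroup_isTopologicalGroup G}.

Definition cyclic_subgroup (G : groupType) (g : G) : set G :=
  range (fun n : nat => g ^+ n)%g `|` range (fun n : nat => g ^- n)%g.

Definition conj_class (G : groupType) (g : G) : set G :=
  range (fun h : G => h * g * h^-1)%g.

Definition nowhere_dense (T : topologicalType) (A : set T) : Prop :=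
  interior (closure A) = set0.

(* Finite unions are covered, since set0 is nowhere dense. *)
Definition meagre (T : topologicalType) (A : set T) : Prop :=
  exists2 F : nat -> set T, (forall n, nowhere_dense (F n)) & A = \bigcup_n F n.

(* A copy of G carrying the Borel sigma-algebra; measurable types have to be
   pointed, and 1 serves as the point. *)
Definition borelType (G : topologicalGroupType) : Type := G.

Section borel_sigma_algebra.
Variable G : topologicalGroupType.

HB.instance Definition _ := Choice.on (borelType G).
HB.instance Definition _ := isPointed.Build (borelType G) (1%g : G).

Let borelC (A : set (borelType G)) : <<s @open G >> A -> <<s @open G >> (~` A).
Proof. by move=> sA; rewrite -setTD; exact: sigma_algebraCD. Qed.

HB.instance Definition _ := @isMeasurable.Build (sigma_display (@open G))
  (borelType G) <<s @open G >> (@sigma_algebra0 _ setT (@open G)) borelC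
  (@sigma_algebra_bigcup _ setT (@open G)).

End borel_sigma_algebra.

(* Left Haar measure: a nonzero left-invariant Radon measure. *)
Record is_haar (R : realType) (G : topologicalGroupType)
    (mu : {measure set (borelType G) -> \bar R}) : Prop := IsHaar {
  haar_neq0 : mu [set: G] <> 0%E ;
  haar_left_invariant : forall (h : G) (A : set (borelType G)),
    measurable A -> mu [set (h * x)%g | x in (A : set G)] = mu A ;
  haar_compact_finite : forall K : set G, compact K -> (mu K < +oo)%E ;
  haar_outer_regular : forall A : set (borelType G), measurable A ->
    mu A = ereal_inf [set mu U | U in [set U : set G | open U /\ A `<=` U]] ;
  haar_inner_regular : forall U : set G, open U ->
    mu U = ereal_sup [set mu K | K in [set K : set G | compact K /\ K `<=` U]]
}.

(* Main.v *)
(** (2) => (1): for an open subgroup L, the class g^G is a countable union of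
    compact sets d (g^L) d^-1, so a non-meagre class has an interior point, and
    conjugation moves it everywhere.  (1) => (2) is the Baire argument with
    compact open sets.

    (3) => (1): since cl<g> is compact, g lies in a compact open subgroup L.
    For N open and normal in L, g^L N is a union of cosets of N and
    mu(L) = k_N mu(g^L N), where k_N is the order of the centralizer of gN in
    L/N.  If the integers k_N are unbounded, then g^L and all its conjugates are
    null, hence so is g^G.  Otherwise take N with k_N maximal: for N' <= N, the
    open set g^L N \ g^L N' is null, hence empty, so that
    gN is contained in the intersection of the g^L N', which is g^L. *)

From HB Require Import structures.
Require Import Defs.
From mathcomp Require Import all_boot all_order all_algebra finmap.
From mathcomp Require Import all_classical all_reals all_analysis.

Import Order.TTheory GRing.Theory Num.Theory.

Set Implicit Arguments.
Unset Strict Implicit.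
Unset Printing Implicit Defensive.

Local Open Scope classical_set_scope.
Local Open Scope ring_scope.

(** * Compact open sets in totally disconnected spaces *)

(** By regularity inside a compact neighbourhood, each point of [A] has a neighbourhood whose
    closure misses [B]. Compactness of [A] then gives one neighbourhood [W] of [B] with [closure W]
    disjoint from [A]. *)
Lemma separate_compact_closed {T : topologicalType} (A B : set T) :
  hausdorff_space T -> (forall x, A x -> exists2 V, compact V & nbhs x V) ->
  compact A -> closed B -> A `&` B = set0 ->
  exists U V, [/\ open U, open V, A `<=` U, B `<=` V & U `&` V = set0].
Proof.
move=> hT lcA /compact_near_coveringP cA clB AB0.
have [[b Bb]|/nonemptyPn ->] := pselect (B !=set0); last first.
  exists setT, set0; split=> //; [exact: openT|exact: open0|exact: setI0].
have pB : ProperFilter (set_nbhs B) by apply: set_nbhs_pfilter; exists b.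
have : forall x, A x ->
    \forall x' \near x & W \near powerset_filter_from (set_nbhs B),
      ~ closure W x'.
  move=> x Ax; have [V cV xV] := lcA x Ax.
  have nB : nbhs x (~` B).
    apply: open_nbhs_nbhs; split; first exact: closed_openC.
    by move=> Bx; have : set0 x by rewrite -AB0.
  have [D xD DB] := compact_regular hT cV xV nB.
  exists (interior D, [set W | W `<=` ~` closure D]); first split.
  - exact: nbhs_interior.
  - apply: small_set_sub => /= y By; apply: open_nbhs_nbhs; split.
      exact/closed_openC/closed_closure.
    by move=> /DB.
  - move=> [y W] /= [Dy WD] clW; have [z [Wz]] := clW _ Dy.
    by move=> /subset_closure; exact: WD.
case/(cA _ _ (fun W x => ~ closure W x)) => F [FB _ [W FW]] /(_ W FW) AW.
have [V [oV BV VW]] := (set_nbhsP _ _).1 (FB W FW).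
exists (~` closure W), V; split=> //.
- exact/closed_openC/closed_closure.
- apply/disjoints_subset/subsetC.
  exact: subset_trans (@subset_closure _ _).
Qed.

(* C ranges over the relatively clopen subsets of K. *)
Definition quasicomponent {T : topologicalType} (K : set T) (x : T) : set T :=
  \bigcap_(C in [set C | [/\ closed C, C `<=` K, closed (K `\` C) & C x]]) C.

(** The sets intersected in [quasicomponent] are stable under finite intersections, so by
    compactness of $K\setminus O$ a single one of them already misses it. *)
Lemma quasicomponent_open {T : topologicalType} (K O : set T) (x : T) :
  compact K -> closed K -> K x -> open O ->
  quasicomponent K x `<=` O ->
  exists C, [/\ closed C, C `<=` K, closed (K `\` C), C x & C `<=` O].
Proof.
move=> cK clK Kx oO QO.
pose F :=
  filter_from [set C | [/\ closed C, C `<=` K, closed (K `\` C) & C x]] id.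
have FK : [set C | [/\ closed C, C `<=` K, closed (K `\` C) & C x]] K.
  by split=> //; rewrite setDv; exact: closed0.
have FF : Filter F.
  apply: filter_from_filter; first by exists K.
  move=> A B [clA AK clKA Ax] [clB BK clKB Bx]; exists (A `&` B) => //.
  split=> //; [exact: closedI|by move=> y [/AK]|].
  by rewrite setDIr; exact: closedU.
have PF : ProperFilter F by apply: filter_from_proper => C [_ _ _ Cx]; exists x.
have /compact_near_coveringP cKO : compact (K `\` O).
  by rewrite setDE; apply: compact_closedI => //; exact: open_closedC.
(* The covering relation [setC] relates [C] to the points outside it, with [C] small along [F]. *)
have [] := cKO _ _ setC (powerset_filter_from_filter PF).
  move=> y [Ky nOy]; have : ~ quasicomponent K x y by move=> /QO.
  move=> /existsNP[C] /not_implyP[[clC CK clKC Cx] nCy].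
  exists (~` C, [set U | U `<=` C]); first split.
  - by apply: open_nbhs_nbhs; split => //; exact: closed_openC.
  - by apply: small_set_sub; exists C.
  - by case=> i j [? /subsetC]; apply.
move=> D [DF _ [C DC]] /(_ _ DC) KOC.
have [B [clB BK clKB Bx] BC] := DF _ DC.
exists B; split=> // y By; apply: contrapT => nOy.
by apply: (KOC y); [split=> //; exact: BK|exact: BC].
Qed.

(** A separation into two closed pieces extends to disjoint open sets [U] and [V], which cut some
    relatively clopen [C] around [x] into two relatively clopen halves. The half containing [x]
    contains the whole quasicomponent, so the other piece is empty. *)
Lemma quasicomponent_connected {T : topologicalType} (K : set T) (x : T) :
  hausdorff_space T -> locally_compact [set: T] -> compact K -> K x ->
  connected (quasicomponent K x).
Proof.
move=> hT lcT cK Kx; set Q := quasicomponent K x.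
have clK := compact_closed hT cK.
have clQ : closed Q by apply: closed_bigI => C [].
have Qx : Q x by move=> C [].
have QK : Q `<=` K.
  by move=> y; apply; split=> //; rewrite setDv; exact: closed0.
apply/connectedP => E [E0 QE [sE1 sE2]].
have clE b : closed (E b).
  move=> y clEy.
  have : Q y.
    apply: clQ; apply: closureS clEy; rewrite QE.
    by case: b; [exact: subsetUr|exact: subsetUl].
  rewrite QE; case: b clEy => clEy [] // Ey.
    by have : set0 y by rewrite -sE2.
  by have : set0 y by rewrite -sE1.
have lc1 (y : T) : exists2 V, compact V & nbhs y V.
  have [V] := lcT y I; rewrite withinET => yV [cV _].
  by exists V.
have cE0 : compact (E false).
  by apply: (subclosed_compact (clE _) cK) => y Ey; apply: QK; rewrite QE; left.
have E01 : E false `&` E true = set0.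
  by apply/disjoints_subset => y Ey E1y; have : set0 y;
    [rewrite -sE1; split=> //; exact: subset_closure|].
have [U [V [oU oV EU EV UV]]] :=
  separate_compact_closed hT (fun y _ => lc1 y) cE0 (clE true) E01.
have [|C [clC CK clKC Cx CUV]] := quasicomponent_open cK clK Kx (openU oU oV).
  by rewrite -/Q QE; exact: setUSS.
have part (A B : set T) : open A -> open B -> A `&` B = set0 ->
    C `<=` A `|` B -> A x -> Q `<=` A.
  move=> oA oB AB CAB Ax y Qy.
  have AC : C `&` A = C `\` B.
    apply/seteqP; split=> z [Cz zA]; split=> //.
      by move=> Bz; have : set0 z by rewrite -AB.
    by have [|] := CAB z Cz.
  suff : (C `&` A) y by case.
  apply: Qy; split=> //.
  - by rewrite AC setDE; apply: closedI => //; exact: open_closedC.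
  - by move=> z [/CK].
  - rewrite setDIr; apply: closedU => //; rewrite setDE.
    by apply: closedI => //; exact: open_closedC.
have [z1 E1z] := E0 true; have [z0 E0z] := E0 false.
have : (U `|` V) x by apply: CUV.
case=> [Ux|Vx].
  have /(part _ _ oU oV UV CUV Ux) Uz : Q z1 by rewrite QE; right.
  by have : set0 z1 by rewrite -UV; split=> //; exact: EV.
have VU : V `&` U = set0 by rewrite setIC.
rewrite setUC in CUV.
have /(part _ _ oV oU VU CUV Vx) Vz : Q z0 by rewrite QE; left.
by have : set0 z0 by rewrite -UV; split=> //; exact: EU.
Qed.

(** The quasicomponent of [x] in a compact neighbourhood is connected, hence reduced to [x], so
    relatively clopen sets around [x] become arbitrarily small. *)
Lemma compact_open_basis {T : topologicalType} (x : T) (W : set T) :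
  hausdorff_space T -> locally_compact [set: T] ->
  totally_disconnected [set: T] -> nbhs x W ->
  exists C : set T, [/\ open C, compact C, C x & C `<=` W].
Proof.
move=> hT lcT tdT xW; have [V] := lcT x I; rewrite withinET => xV [cV clV].
have Vx : V x := nbhs_singleton xV.
pose O := interior (W `&` V).
have Ox : O x by apply: nbhs_singleton; apply: nbhs_interior; exact: filterI.
have oO : open O by exact: open_interior.
have OV : O `<=` V by move=> y /interior_subset[].
have QO : quasicomponent V x `<=` O.
  move=> y Qy; suff -> : y = x by [].
  have : connected_component setT x y.
    eexists; last exact: Qy.
    by split=> //; [move=> C []|exact: quasicomponent_connected].
  by rewrite tdT.
have [C [clC CV clVC Cx CO]] := quasicomponent_open cV clV Vx oO QO.
exists C; split=> //.
(* [C] is relatively open in [V] and lies in the open set [O] inside [V], hence is open in the whole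
   space. *)
- rewrite (_ : C = O `&` ~` (V `\` C)).
    by apply: openI => //; exact: closed_openC.
  apply/seteqP; split=> y; first by move=> Cy; split; [exact: CO|case].
  by move=> [/OV Vy /not_andP[]// /contrapT].
- exact: subclosed_compact cV CV.
- by move=> y /CO /interior_subset[].
Qed.

(** * Totally disconnected locally compact groups *)

Section TopologicalGroup.
Local Open Scope group_scope.
Variable G : topologicalGroupType.
Implicit Types (A B C H K L N U W : set G) (g h t x y z : G).

Lemma continuousMg {T : topologicalType} (f k : T -> G) :
  continuous f -> continuous k -> continuous (fun u => f u * k u).
Proof.
move=> cf ck u.
apply: (@continuous_comp _ _ _ (fun u => (f u, k u))
  (fun p : G * G => p.1 * p.2)); last exact: mulg_continuous.
by apply: cvg_pair; [exact: cf|exact: ck].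
Qed.

Lemma continuous_conj g : continuous (fun x => x * g * x^-1).
Proof.
apply: continuousMg; last exact: invg_continuous.
by apply: continuousMg => x; [exact: cvg_id|exact: cvg_cst].
Qed.

(** Cosets are preimages under translations, which makes openness immediate; [lcosetE] and [rcosetE]
    give the images needed for compactness and invariance. *)
Definition lcoset x A : set G := [set z | A (x^-1 * z)].
Definition rcoset A t : set G := [set z | A (z * t^-1)].

Lemma lcosetE x A : lcoset x A = [set x * y | y in A].
Proof.
apply/seteqP; split=> z.
  by move=> Az; exists (x^-1 * z) => //; rewrite mulVKg.
by case=> y Ay <-; rewrite /lcoset/= mulKg.
Qed.

Lemma rcosetE A t : rcoset A t = [set y * t | y in A].
Proof.
apply/seteqP; split=> z.
  by move=> Az; exists (z * t^-1) => //; rewrite mulgVK.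
by case=> y Ay <-; rewrite /rcoset/= mulgK.
Qed.

Lemma lcoset_rcoset x A t : lcoset x (rcoset A t) = rcoset (lcoset x A) t.
Proof. by apply/seteqP; split=> z; rewrite /lcoset /rcoset/= mulgA. Qed.

Let continuous_mul x t : continuous (fun z => x * z * t).
Proof.
apply: continuousMg => [|?]; last exact: cvg_cst.
by apply: continuousMg => ?; [exact: cvg_cst|exact: cvg_id].
Qed.

Let continuous_mull x : continuous (fun z => x * z).
Proof. by apply: continuousMg => ?; [exact: cvg_cst|exact: cvg_id]. Qed.

Let continuous_mulr t : continuous (fun z => z * t).
Proof. by apply: continuousMg => ?; [exact: cvg_id|exact: cvg_cst]. Qed.

Lemma open_lcoset x A : open A -> open (lcoset x A).
Proof. by move=> oA; apply: open_comp => // y _; exact: continuous_mull. Qed.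

Lemma open_rcoset A t : open A -> open (rcoset A t).
Proof. by move=> oA; apply: open_comp => // y _; exact: continuous_mulr. Qed.

Lemma compact_lcoset x A : compact A -> compact (lcoset x A).
Proof.
move=> cA; rewrite lcosetE; apply: continuous_compact => //.
exact/continuous_subspaceT/continuous_mull.
Qed.

Lemma compact_rcoset A t : compact A -> compact (rcoset A t).
Proof.
move=> cA; rewrite rcosetE; apply: continuous_compact => //.
exact/continuous_subspaceT/continuous_mulr.
Qed.

(** * Open subgroups, transversals and cores *)

Definition subgroup H :=
  [/\ H 1, forall x y, H x -> H y -> H (x * y) & forall x, H x -> H x^-1].

Lemma subgroup_open H : subgroup H -> nbhs 1 H -> open H.
Proof.
move=> [H1 HM HV] nH; rewrite openE => x Hx.
have : nbhs x (fun z => H (x^-1 * z)).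
  by apply: (@continuous_mull x^-1 x); rewrite /= mulVg.
by apply: filterS => z /(HM _ _ Hx); rewrite mulVKg.
Qed.

(** Both [A] and its complement are unions of left cosets of the open subgroup [H]. *)
Lemma clopen_rinvariant A H : subgroup H -> open H ->
  (forall a h, A a -> H h -> A (a * h)) -> clopen A.
Proof.
move=> [H1 HM HV] oH; have oAH B :
    (forall a h, B a -> H h -> B (a * h)) -> open B.
  move=> BH; rewrite openE => x Bx.
  have : lcoset x H `<=` B by move=> z /(BH _ _ Bx); rewrite mulVKg.
  move=> /filterS; apply; apply: open_nbhs_nbhs; split.
    exact: open_lcoset.
  by rewrite /lcoset/= mulVg.
move=> AH; split; first exact: oAH.
rewrite -openC; apply: oAH => a h nAa Hh Aah; apply: nAa.
by rewrite -(mulgK h a); apply: AH => //; exact: HV.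
Qed.

(** Covering [A] by the cosets of canonical representatives makes any finite subcover free of
    repetitions. *)
Lemma lcoset_transversal A H : subgroup H -> open H -> compact A ->
  (forall a h, A a -> H h -> A (a * h)) ->
  exists D : set G, [/\ finite_set D, D `<=` A,
    A = \bigcup_(x in D) lcoset x H &
    forall x y, D x -> D y -> H (x^-1 * y) -> x = y].
Proof.
move=> [H1 HM HV] oH cA AH.
pose T : ptopologicalType := HB.pack (Topological.sort G)
  (isPointed.Build (Topological.sort G) (1 : G)).
have ccA : cover_compact A by move: cA; rewrite (@compact_cover T).
(* The value of [choose] depends only on the predicate, here membership in the coset of [x], so
   [rep] is constant on cosets. *)
pose rep x : G := choose (fun y => `[< H (x^-1 * y) >]) x.
have repP x : H (x^-1 * rep x).
  by apply/asboolP; apply: (@chooseP G (fun y => `[< H (x^-1 * y) >]));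
    rewrite mulVg; apply/asboolP.
have rep_eq x y : H (x^-1 * y) -> rep x = rep y.
  move=> Hxy; have E :
      (fun z => `[< H (x^-1 * z) >]) = (fun z => `[< H (y^-1 * z) >]).
    apply/funext => z; apply: asbool_equiv_eq; split.
      by move=> /(HM _ _ (HV _ Hxy)); rewrite invgM invgK -mulgA mulVKg.
    by move=> /(HM _ _ Hxy); rewrite -mulgA mulVKg.
  rewrite /rep E; apply: choose_id; apply/asboolP; last by rewrite mulVg.
  by move: (HV _ Hxy); rewrite invgM invgK.
have [|x Ax|D DA AD] := ccA G (rep @` A) (fun x => lcoset x H).
- by move=> x _; exact: open_lcoset.
- exists (rep x); first by exists x.
  by move: (HV _ (repP x)); rewrite invgM invgK.
have DrA : [set` D] `<=` rep @` A by move=> x /= /DA; rewrite inE.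
have DsubA : [set` D] `<=` A.
  move=> x /DrA [y Ay <-].
  by rewrite -(mulVKg y (rep y)); apply: AH => //; exact: repP.
exists [set` D]; split=> //.
- apply/seteqP; split=> [|z [x /DsubA Ax Hxz]]; first exact: AD.
  by rewrite -(mulVKg x z); exact: AH.
- move=> x y /DrA[x' _ <-] /DrA[y' _ <-] Hxy.
  apply: rep_eq; have := HM _ _ (HM _ _ (repP x') Hxy) (HV _ (repP y')).
  by rewrite invgM invgK -!mulgA !mulVKg.
Qed.

Lemma cyclic_subgroupP g z :
  cyclic_subgroup g z <-> exists m n, z = g ^+ m * g ^- n.
Proof.
split=> [[[n _ <-]|[n _ <-]]|[m [n ->]]].
- by exists n, 0%N; rewrite expg0 invg1 mulg1.
- by exists 0%N, n; rewrite expg0 mul1g.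
- have [nm|mn] := leqP n m.
    by left; exists (m - n)%N => //; rewrite expgnFr.
  right; exists (n - m)%N => //=.
  by rewrite expgnFr ?invgF// ltnW.
Qed.

Lemma subgroup_cyclic g : subgroup (cyclic_subgroup g).
Proof.
have cVX m n : commute (g ^- n) (g ^+ m).
  by apply: commute_sym; apply: commuteV; exact: commuteX2.
split.
- by left; exists 0%N.
- move=> x y /cyclic_subgroupP[m [n ->]] /cyclic_subgroupP[p [q ->]].
  apply/cyclic_subgroupP; exists (m + p)%N, (q + n)%N.
  by rewrite !expgnDr invgM !mulgA -(mulgA (g ^+ m)) cVX !mulgA.
- move=> x /cyclic_subgroupP[m [n ->]]; apply/cyclic_subgroupP; exists n, m.
  by rewrite invgM invgK.
Qed.

(** This is the intersection of the conjugates $cUc^{-1}$ over $c\in C$. *)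
Definition conj_core C U : set G := [set x | forall c, C c -> U (c^-1 * x * c)].

Lemma subgroup_conj_core C U : subgroup U -> subgroup (conj_core C U).
Proof.
move=> [U1 UM UV]; split.
- by move=> c _; rewrite mulg1 mulVg.
- move=> x y Ux Uy c Cc; have := UM _ _ (Ux c Cc) (Uy c Cc).
  by rewrite !mulgA mulgK.
- by move=> x Ux c Cc; have := UV _ (Ux c Cc); rewrite !invgM invgK mulgA.
Qed.

(** Near each $c\in C$, conjugation maps a neighbourhood of 1 into [U] by continuity; compactness of
    [C] makes this neighbourhood uniform. *)
Lemma nbhs_conj_core C U : compact C -> U 1 -> open U -> nbhs 1 (conj_core C U).
Proof.
move=> /compact_near_coveringP cC U1 oU.
apply: (cC G (nbhs 1) (fun w x => U (x^-1 * w * x))) => x Cx.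
have cont : continuous (fun p : G * G => p.1^-1 * p.2 * p.1).
  apply: continuousMg; last by move=> p; exact: cvg_fst.
  apply: continuousMg; last by move=> p; exact: cvg_snd.
  by move=> p; apply: continuous_comp; [exact: cvg_fst|exact: invg_continuous].
apply: (cont (x, 1)); rewrite /= mulg1 mulVg.
exact: open_nbhs_nbhs.
Qed.

(** * Compact open subgroups and the Baire property *)

Section LocallyCompact.
Hypotheses (hausG : hausdorff_space G) (lcG : locally_compact [set: G])
  (tdG : totally_disconnected [set: G]).

(** For a compact open [C] inside [W] with $1\in C$, the group of all $w$ with $Cw=C$ is contained
    in [C], and compactness of [C] makes it open. *)
Lemma van_dantzig W : nbhs 1 W ->
  exists U, [/\ subgroup U, open U, compact U & U `<=` W].
Proof.
move=> nW; have [C [oC cC C1 CW]] := compact_open_basis hausG lcG tdG nW.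
pose S : set G := [set w | forall x, C x -> C (x * w)].
have nS : nbhs 1 S.
  have /compact_near_coveringP ncC := cC.
  apply: (ncC G (nbhs 1) (fun w x => C (x * w))) => x Cx.
  by apply: (mulg_continuous (x, 1)); rewrite /= mulg1; exact: open_nbhs_nbhs.
pose U : set G := [set w | S w /\ S w^-1].
have sU : subgroup U.
  split.
  - by split; rewrite ?invg1 => x Cx; rewrite mulg1.
  - move=> x y [Sx Sx'] [Sy Sy']; split=> z Cz.
      by rewrite mulgA; apply: Sy; exact: Sx.
    by rewrite invgM mulgA; apply: Sx'; exact: Sy'.
  - by move=> x [Sx Sx']; split=> //; rewrite invgK.
have oU : open U.
  apply: subgroup_open => //; apply: filterI => //.
  by apply: (@invg_continuous G 1); rewrite invg1.
have UC : U `<=` C by move=> x [/(_ _ C1)]; rewrite mul1g.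
exists U; split=> //; last exact: subset_trans CW.
apply: subclosed_compact cC UC.
by have [_ UM _] := sU; have [] := clopen_rinvariant sU oU UM.
Qed.

(** The core over [L] of a small compact open subgroup is normal in [L], and compactness of [L]
    keeps it open. *)
Lemma small_normal_subgroup L W : subgroup L -> open L -> compact L ->
  nbhs 1 W -> exists N, [/\ subgroup N, open N, N `<=` L, N `<=` W &
    forall x y, L x -> N y -> N (x^-1 * y * x)].
Proof.
move=> [L1 LM LV] oL cL nW; have [|U [sU oU cU UWL]] := @van_dantzig (W `&` L).
  by apply: filterI => //; exact: open_nbhs_nbhs.
have [U1 _ _] := sU.
have NU : conj_core L U `<=` U.
  by move=> x /(_ _ L1); rewrite invg1 mul1g mulg1.
exists (conj_core L U); split.
- exact: subgroup_conj_core.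
- by apply: subgroup_open; [exact: subgroup_conj_core|exact: nbhs_conj_core].
- by move=> x /NU /UWL[].
- by move=> x /NU /UWL[].
- move=> x y Lx Ny c Lc; have := Ny _ (LM _ _ Lx Lc).
  by rewrite invgM !mulgA.
Qed.

(** For $Z=\langle g\rangle$ and a compact open subgroup [U], the core $V=\bigcap_{c\in Z}cUc^{-1}$
    is normalized by [Z], so $L=ZV$ is a subgroup. *)
Lemma compact_open_subgroup_containing g :
  compact (closure (cyclic_subgroup g)) ->
  exists L, [/\ subgroup L, open L, compact L & L g].
Proof.
set Z := cyclic_subgroup g => cC; have [Z1 ZM ZV] := subgroup_cyclic g.
have [U [sU oU cU _]] := van_dantzig filterT.
have [U1 _ _] := sU; pose V := conj_core Z U.
have [V1 VM VV] := subgroup_conj_core Z sU.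
have nV : nbhs 1 V.
  (* The core over the compact closure of [Z] is a neighbourhood of 1 and lies inside [V]. *)
  apply: filterS (nbhs_conj_core cC U1 oU) => x Ux c Zc.
  by apply: Ux; exact: subset_closure.
have oV : open V by apply: subgroup_open => //; exact: subgroup_conj_core.
have cV : compact V.
  apply: (subclosed_compact _ cU).
    by have [] := @clopen_rinvariant V V (subgroup_conj_core Z sU) oV VM.
  by move=> x /(_ _ Z1); rewrite invg1 mul1g mulg1.
have VJ d v : Z d -> V v -> V (d^-1 * v * d).
  move=> Zd Vv c Zc; have := Vv _ (ZM _ _ Zd Zc).
  by rewrite invgM !mulgA.
pose L : set G := [set z | exists2 c, Z c & V (c^-1 * z)].
have VL : V `<=` L by move=> v Vv; exists 1 => //; rewrite invg1 mul1g.
have sL : subgroup L.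
  split.
  - exact: VL.
  - move=> x y [c Zc Vx] [d Zd Vy]; exists (c * d); first exact: ZM.
    have := VM _ _ (VJ _ _ Zd Vx) Vy.
    by rewrite invgM !mulgA mulgK.
  - move=> x [c Zc Vx]; exists c^-1; first exact: ZV.
    have := VJ _ _ (ZV _ Zc) (VV _ Vx).
    by rewrite invgM !invgK !mulgA mulgK.
have oL : open L.
  by apply: subgroup_open => //; apply: filterS nV.
exists L; split=> //; last first.
  by exists g; [left; exists 1%N|rewrite mulVg].
have [_ clL] : clopen L.
  by have [_ LM _] := sL; exact: clopen_rinvariant sL oL LM.
(* The open subgroup [L] is closed and lies in the compact product of [closure Z] and [V]. *)
have cCV : compact [set p.1 * p.2 | p in closure Z `*` V].
  apply: continuous_compact; last exact: compact_setX.
  exact/continuous_subspaceT/mulg_continuous.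
apply: subclosed_compact clL cCV _ => z [c Zc Vz].
by exists (c, c^-1 * z); [split=> //; exact: subset_closure|rewrite /= mulVKg].
Qed.

(** Decreasing nonempty compact open sets [K n] are chosen inside [A], with [K n.+1] missing [F n];
    a point common to all of them is in [A] but in no [F n]. *)
Lemma open_not_meagre A : open A -> A !=set0 -> ~ meagre A.
Proof.
move=> oA [a Aa] [F ndF AF].
pose X := {C : set G | [/\ open C, compact C & C !=set0]}.
pose X0 C oC cC nC : X := exist _ C (And3 oC cC nC).
have sub x O : open O -> O x -> exists C : X, sval C `<=` O.
  move=> oO Ox; have [C [oC cC Cx CO]] :=
    compact_open_basis hausG lcG tdG (open_nbhs_nbhs (conj oO Ox)).
  by exists (X0 C oC cC (ex_intro _ x Cx)).
have step (nC : nat * X) : exists D : X,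
    sval D `<=` sval nC.2 /\ sval D `&` F nC.1 = set0.
  case: nC => n [C [oC cC [x Cx]]] /=.
  have [y [Cy nFy]] : (C `&` ~` closure (F n)) !=set0.
    apply: contrapT => /nonemptyPn CF0; have : set0 x; last by [].
    rewrite -(ndF n); apply: filterS (open_nbhs_nbhs (conj oC Cx)) => y Cy.
    by apply: contrapT => nFy; have : set0 y; [rewrite -CF0|].
  have [||D DO] := @sub y (C `&` ~` closure (F n)) => //.
    by apply: openI => //; exact/closed_openC/closed_closure.
  exists D; split; first by move=> z /DO[].
  apply/disjoints_subset => z /DO[_].
  by apply: contra_not; exact: subset_closure.
have [next nextP] := choice step.
have [C0 C0A] := sub a A oA Aa.
pose K := fix K n : X := if n is m.+1 then next (m, K m) else C0.
have KS m n : (m <= n)%N -> sval (K n) `<=` sval (K m).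
  elim: n => [|n IH]; first by rewrite leqn0 => /eqP ->.
  rewrite leq_eqVlt => /predU1P[->//|/IH]; apply: subset_trans.
  by have [] := nextP (n, K n).
have PF : ProperFilter (filter_from [set: nat] (fun n => sval (K n))).
  apply: filter_from_proper; last by move=> n _; case: (K n) => C [].
  apply: filter_from_filter; first by exists 0%N.
  move=> m n _ _; exists (maxn m n) => // x Kx.
  by split; apply: KS Kx; rewrite ?leq_maxl ?leq_maxr.
have [_ cK0 _] := svalP (K 0%N).
(* A cluster point exists in the compact [K 0]; it belongs to every [K n] because these are
   closed. *)
have [|p [K0p clp]] := cK0 _ PF; first by exists 0%N.
have Kp n : sval (K n) p.
  have [_ cKn _] := svalP (K n); apply: (compact_closed hausG cKn).
  by move=> B Bp; apply: clp Bp; exists n.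
have : A p by apply: C0A; exact: (Kp 0%N).
rewrite AF => -[n _ Fp]; have [_ KF] := nextP (n, K n).
by have : set0 p; [rewrite -KF; split=> //; exact: (Kp n.+1)|].
Qed.

End LocallyCompact.

Lemma dense_sequence : @second_countable G ->
  exists d : nat -> G, forall A, open A -> A !=set0 -> exists n, A (d n).
Proof.
move=> [B /countable_injP[f finj] [oB bB]].
(* The injection [f] numbers the base: [d n] is a point of the member numbered [n], or 1 if there is
   no such nonempty member. *)
pose d n := xget 1 [set x | exists2 b, B b /\ f b = n & b x].
exists d => A oA [a Aa].
have [b [Bb ba] bA] := bB a A (open_nbhs_nbhs (conj oA Aa)).
exists (f b); apply: bA.
have [b' [Bb' fb'] b'd] :
    [set x | exists2 b', B b' /\ f b' = f b & b' x] (d (f b)).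
  by apply: (@xgetPex _ 1); exists a, b.
by rewrite {1}(finj b b' (mem_set Bb) (mem_set Bb') (esym fb')).
Qed.

(** Conjugations are homeomorphisms that permute the class transitively, so one interior point makes
    every point interior. *)
Lemma open_conj_class g A : open A -> A !=set0 -> A `<=` conj_class g ->
  open (conj_class g).
Proof.
move=> oA [a Aa] AG; rewrite openE => z [x _ <-].
have [y _ ya] := AG a Aa.
pose u := y * x^-1.
have : nbhs (x * g * x^-1) [set w | A (u * w * u^-1)].
  apply: continuous_mul; rewrite /= /u.
  rewrite (_ : _ * _ * _ = a); first exact: open_nbhs_nbhs.
  by rewrite -ya invgM invgK !mulgA !mulgVK.
clearbody u; apply: filterS => w /AG[v _ vw]; exists (u^-1 * v) => //=.
have -> : w = u^-1 * (u * w * u^-1) * u by rewrite !mulgA mulVg mul1g mulgVK.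
by rewrite -vw invgM invgK !mulgA.
Qed.

End TopologicalGroup.

(** * Conjugacy classes and Haar measure *)

Section NormalSubgroup.
Local Open Scope group_scope.
Variable G : topologicalGroupType.
Implicit Types (A B H L N W : set G) (g t x y z : G).

Definition conj_orbit L g : set G := [set x * g * x^-1 | x in L].

(** This is the product set $AN$; with [conj_orbit L g] for [A] it is $g^L N$. *)
Definition thicken A N : set G := [set z | exists2 a, A a & N (a^-1 * z)].

Definition open_normal L N :=
  [/\ subgroup N, open N, N `<=` L &
    forall x y, L x -> N y -> N (x^-1 * y * x)].

Lemma rcoset1 A : rcoset A 1 = A.
Proof. by apply/seteqP; split=> z; rewrite /rcoset/= invg1 mulg1. Qed.

Lemma subset_thicken A N : subgroup N -> A `<=` thicken A N.
Proof. by move=> [N1 _ _] a Aa; exists a => //; rewrite mulVg. Qed.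

Lemma clopen_thicken A N : subgroup N -> open N -> clopen (thicken A N).
Proof.
move=> sN oN; have [_ NM _] := sN; apply: (clopen_rinvariant sN oN).
by move=> z n [a Aa Nz] Nn; exists a => //; rewrite mulgA; exact: NM.
Qed.

(** If $z\notin A$, then $zw^{-1}\notin A$ for all $w$ near 1, so $z\notin AN$ for small [N]. *)
Lemma closed_thicken A B : closed A ->
  (forall W, nbhs 1 W -> exists2 N, N `<=` W & B `<=` thicken A N) ->
  B `<=` A.
Proof.
move=> clA KA z Kz; apply: contrapT => nAz.
pose W : set G := [set w | ~ A (z * w^-1)].
have nW : nbhs 1 W.
  have cont : continuous (fun w : G => z * w^-1).
    by apply: continuousMg; [move=> u; exact: cvg_cst|exact: invg_continuous].
  have := cont 1 (~` A); rewrite /= invg1 mulg1; apply.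
  by apply: open_nbhs_nbhs; split=> //; exact: closed_openC.
have [N NW /(_ z Kz)[a Aa /NW]] := KA W nW.
by rewrite /W/= invgM invgK mulVKg.
Qed.

Lemma compact_conj_orbit L g : compact L -> compact (conj_orbit L g).
Proof.
move=> cL; apply: continuous_compact => //.
exact/continuous_subspaceT/continuous_conj.
Qed.

(** For [N] normal in [L] and $g\in L$, this is the preimage in [L] of the centralizer of $gN$ in
    $L/N$. *)
Definition stabilizer_mod L N g : set G :=
  [set x | L x /\ N (g^-1 * (x * g * x^-1))].

(** Orbit-stabilizer correspondence: the cosets of [N] in $g^L N$ are parametrized by the left
    cosets of the stabilizer in [L]. *)
Lemma stabilizer_modP L N g x y : subgroup L -> open_normal L N -> L x -> L y ->
  N ((x * g * x^-1)^-1 * (y * g * y^-1)) <-> stabilizer_mod L N g (x^-1 * y).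
Proof.
move=> [L1 LM LV] [sN _ _ NJ] Lx Ly; rewrite /stabilizer_mod/=.
have E : g^-1 * (x^-1 * y * g * (x^-1 * y)^-1) =
    x^-1 * ((x * g * x^-1)^-1 * (y * g * y^-1)) * x.
  by rewrite !invgM !invgK !mulgA mulVg mul1g.
rewrite E; split=> [Nxy|[_ /(NJ _ _ (LV _ Lx))]].
  by split; [apply: LM => //; exact: LV|exact: NJ].
by rewrite invgK !mulgA mulgV mul1g mulgK.
Qed.

Lemma subgroup_stabilizer_mod L N g : subgroup L -> open_normal L N ->
  subgroup (stabilizer_mod L N g).
Proof.
move=> [L1 LM LV] [[N1 NM NV] _ _ NJ]; split.
- by split=> //; rewrite invg1 mul1g mulg1 mulVg.
- move=> x y [Lx Nx] [Ly Ny]; split; first exact: LM.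
  have := NM _ _ Nx (NJ _ _ (LV _ Lx) Ny).
  by rewrite invgM invgK !mulgA mulgVK mulgK.
- move=> x [Lx Nx]; split; first exact: LV.
  by have := NJ _ _ Lx (NV _ Nx); rewrite !invgM !invgK !mulgA mulVg mul1g.
Qed.

(** Since $g\in L$ normalizes [N], both $g^{-1}ng$ and $n^{-1}$ lie in [N]. This makes the
    stabilizer open. *)
Lemma sub_stabilizer_mod L N g : subgroup L -> L g -> open_normal L N ->
  N `<=` stabilizer_mod L N g.
Proof.
move=> [L1 LM LV] Lg [[N1 NM NV] _ NL NJ] n Nn; split; first exact: NL.
by have := NM _ _ (NJ _ _ Lg Nn) (NV _ Nn); rewrite !mulgA.
Qed.

End NormalSubgroup.

(** * Haar measure of open sets and of unions of cosets *)

Section Haar.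
Variables (G : topologicalGroupType) (R : realType)
  (mu : {measure set (borelType G) -> \bar R}).
Hypotheses (hausG : hausdorff_space G) (haar_mu : is_haar mu).
Implicit Types (A B H L N : set G) (g t x y z : G).

Lemma borel_open A : open A -> measurable (A : set (borelType G)).
Proof. by move=> oA; exact: (@sub_sigma_algebra G setT (@open G) A oA). Qed.

Lemma borel_compact A : compact A -> measurable (A : set (borelType G)).
Proof.
move=> /(compact_closed hausG) cA; rewrite -[A]setCK; apply: measurableC.
by apply: borel_open; exact: closed_openC.
Qed.

Lemma haar_lcoset x A : measurable (A : set (borelType G)) ->
  mu (lcoset x A) = mu A.
Proof. by move=> mA; rewrite lcosetE; exact: haar_left_invariant. Qed.

Lemma haar_fin_num A : compact A -> mu A \is a fin_num.
Proof. by move=> cA; rewrite ge0_fin_numE//; exact: haar_compact_finite. Qed.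

(** Countably many left translates of [A], by a dense sequence, cover [G]; were [A] null, [G] would
    be null. *)
Lemma haar_open_gt0 A : @second_countable G -> open A -> A !=set0 ->
  (0 < mu A)%E.
Proof.
move=> scG oA [a Aa]; rewrite lt0e measure_ge0 andbT; apply/eqP => A0.
have [d dP] := dense_sequence scG.
apply: (haar_neq0 haar_mu); apply/(negligibleP mu); first exact: measurableT.
have -> : [set: G] = \bigcup_n lcoset (d n) A.
  apply/seteqP; split=> // z _.
  have [||n dn] := dP [set y | A (y^-1 * z)%g].
  - apply: open_comp => // y _.
    apply: continuousMg => [|u]; last exact: cvg_cst.
    exact: invg_continuous.
  - by exists (z * a^-1)%g; rewrite /= invgM invgK mulgVK.
  by exists n.
apply: negligible_bigcup => n; apply/negligibleP.
  by apply: borel_open; exact: open_lcoset.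
by rewrite -A0; apply: haar_lcoset; exact: borel_open.
Qed.

(** Left and right translations commute, so the set is a disjoint union of left translates of $Ht$,
    all of the same finite measure. *)
Lemma haar_bigcup_lcoset (D : set G) (f : G -> G) H t :
  finite_set D -> subgroup H -> open H -> compact H ->
  (forall x y, D x -> D y -> H ((f x)^-1 * f y)%g -> x = y) ->
  mu (rcoset (\bigcup_(x in D) lcoset (f x) H) t) =
  ((#|` fset_set D|)%:R * fine (mu (rcoset H t)))%:E.
Proof.
move=> fD [H1 HM HV] oH cH Df.
have -> : rcoset (\bigcup_(x in D) lcoset (f x) H) t =
    \bigcup_(x in D) lcoset (f x) (rcoset H t).
  apply/seteqP; split=> z [x Dx Hz]; exists x => //; move: Hz.
    by rewrite lcoset_rcoset.
  by rewrite lcoset_rcoset.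
have oHt : open (rcoset H t) by exact: open_rcoset.
rewrite measure_fin_bigcup//; last 2 first.
- move=> x y Dx Dy [z [Hx Hy]]; apply: Df => //.
  have := HM _ _ Hx (HV _ Hy).
  by rewrite !invgM !invgK -!mulgA !(mulgA t^-1%g) mulVg mul1g mulVKg.
- by move=> x Dx; apply: borel_open; exact: open_lcoset.
rewrite fsbig_finite//= (eq_bigr (fun=> (fine (mu (rcoset H t)))%:E)).
  by rewrite sumEFin big_const_seq count_predT iter_addr_0 mulr_natl.
move=> x _; rewrite fineK; last exact/haar_fin_num/compact_rcoset.
by apply: haar_lcoset; exact: borel_open.
Qed.

(* Here k is the index of N in stabilizer_mod L N g.  The translation by t is
   there because mu is only left-invariant; k does not depend on it. *)
Lemma haar_thicken L N g : subgroup L -> open L -> compact L -> L g ->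
  open_normal L N ->
  exists k : nat, forall t, mu (rcoset L t) =
    (k%:R * fine (mu (rcoset (thicken (conj_orbit L g) N) t)))%:E.
Proof.
move=> sL oL cL Lg nN; have [sN oN NL NJ] := nN.
have [L1 LM LV] := sL; have [N1 NM NV] := sN.
pose S := stabilizer_mod L N g.
have sS : subgroup S by exact: subgroup_stabilizer_mod.
have NS : N `<=` S by exact: sub_stabilizer_mod.
have [S1 SM SV] := sS.
have SL : S `<=` L by move=> x [].
have oS : open S.
  by apply: subgroup_open => //; apply: filterS NS _; exact: open_nbhs_nbhs.
have cS : compact S.
  by apply: subclosed_compact cL SL; have [] := clopen_rinvariant sS oS SM.
have cN : compact N.
  by apply: subclosed_compact cL NL; have [] := clopen_rinvariant sN oN NM.
have [|D [fD DL LE Dinj]] := lcoset_transversal sS oS cL.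
  by move=> a h La /SL; exact: LM.
have [|E [fE ES SE Einj]] := lcoset_transversal sN oN cS.
  by move=> a h Sa /NS; exact: SM.
have TE : thicken (conj_orbit L g) N =
    \bigcup_(x in D) lcoset (x * g * x^-1)%g N.
  apply/seteqP; split=> [z [_ [x Lx <-] Nz]|z [x Dx Nz]]; last first.
    by exists (x * g * x^-1)%g => //; exists x => //; exact: DL.
  have [d Dd Sdx] : (\bigcup_(x in D) lcoset x S) x by rewrite -LE.
  have /(stabilizer_modP _ sL nN (DL _ Dd) Lx) Ndx := Sdx.
  exists d => //; have := NM _ _ Ndx Nz.
  by rewrite -mulgA mulVKg.
(* Here $\mu(Lt)=|D||E|\mu(Nt)$, while $g^L N$ consists of $|D|$ cosets of [N]; the quotient is
   $|E|$. *)
exists #|` fset_set E| => t.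
rewrite TE (haar_bigcup_lcoset (f := fun x => x * g * x^-1)%g)//; last first.
  move=> x y Dx Dy /(stabilizer_modP _ sL nN (DL _ Dx) (DL _ Dy)).
  exact: Dinj.
rewrite {1}LE (haar_bigcup_lcoset (f := id))//.
rewrite {1}SE (haar_bigcup_lcoset (f := id))//=.
by rewrite mulrCA.
Qed.

End Haar.

(** * Openness of non-meagre and of non-null classes *)

Section Conclusion.
Variables (G : topologicalGroupType) (R : realType)
  (mu : {measure set (borelType G) -> \bar R}).
Hypotheses (hausG : hausdorff_space G) (lcG : locally_compact [set: G])
  (tdG : totally_disconnected [set: G]) (scG : @second_countable G).
Implicit Types (A B H L N : set G) (g t x y z : G).

(** Density puts some $d_n$ in each coset $xL$; writing $x=d_n l$ gives
    $xgx^{-1}=d_n(lgl^{-1})d_n^{-1}$. *)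
Lemma conj_class_bigcup g L : subgroup L -> open L ->
  exists d : nat -> G,
    conj_class g = \bigcup_n lcoset (d n) (rcoset (conj_orbit L g) (d n)^-1%g).
Proof.
move=> [L1 LM LV] oL; have [d dP] := dense_sequence scG; exists d.
apply/seteqP; split=> [z [x _ <-]|z [n _]].
  have [||n dn] := dP [set y | L (y^-1 * x)%g].
  - apply: open_comp => // y _.
    apply: continuousMg => [|u]; last exact: cvg_cst.
    exact: invg_continuous.
  - by exists x; rewrite /= mulVg.
  exists n => //; exists ((d n)^-1 * x)%g => //.
  by rewrite invgM !invgK !mulgA.
rewrite /lcoset /rcoset/= invgK => -[x _ xE]; exists (d n * x)%g => //.
by rewrite invgM !mulgA -(mulgA (d n)) -(mulgA (d n)) xE mulgA mulVKg mulgK.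
Qed.

Lemma nonmeagre_open_conj_class g : ~ meagre (conj_class g) ->
  open (conj_class g).
Proof.
move=> nm; have [L [sL oL cL _]] := van_dantzig hausG lcG tdG filterT.
have [d dE] := conj_class_bigcup g sL oL.
pose P n := lcoset (d n) (rcoset (conj_orbit L g) (d n)^-1%g).
have clP n : closed (P n).
  apply: (compact_closed hausG); apply/compact_lcoset/compact_rcoset.
  exact: compact_conj_orbit.
(* The [P n] are closed, so with empty interiors they would all be nowhere dense. *)
have [n [x Px]] : exists n, interior (P n) !=set0.
  apply: contrapT => /forallNP nP; apply: nm; exists P => // n.
  by rewrite /nowhere_dense -(closure_id _).1//; apply/nonemptyPn; exact: nP.
apply: (@open_conj_class _ _ (interior (P n))); first exact: open_interior.
  by exists x.
by rewrite dE => y /interior_subset Py; exists n.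
Qed.

Hypothesis haar_mu : is_haar mu.

Lemma nonnegligible_open_conj_class g : compact (closure (cyclic_subgroup g)) ->
  ~ mu.-negligible (conj_class g) -> open (conj_class g).
Proof.
move=> cg nn.
have [L [sL oL cL Lg]] := compact_open_subgroup_containing hausG lcG tdG cg.
have [L1 LM LV] := sL.
pose A := conj_orbit L g.
have cA : compact A by exact: compact_conj_orbit.
(* Here [k] plays the role of $k_N$, for all right translates at once: $t=1$ serves to compare
   subgroups, $t=d_n^{-1}$ to treat the conjugates of $g^L$. *)
pose index N k := forall t, mu (rcoset L t) =
  (k%:R * fine (mu (rcoset (thicken A N) t)))%:E.
have thickL N : open_normal L N -> thicken A N `<=` L.
  move=> [_ _ NL _] z [_ [x Lx <-] /NL Lz].
  rewrite -(mulVKg (x * g * x^-1)%g z); apply: (LM) => //.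
  by apply: (LM); [exact: LM|exact: LV].
have muL : (0 < mu L)%E by apply: haar_open_gt0 => //; exists 1%g.
have [m mP] : exists m : nat,
    forall N k, open_normal L N -> index N k -> (k <= m)%N.
  apply: contrapT => /forallNP unb; apply: nn.
  have [d ->] := conj_class_bigcup g sL oL.
  apply: negligible_bigcup => n; set t := (d n)^-1%g.
  have cAt : compact (rcoset A t) by exact: compact_rcoset.
  apply/negligibleP.
    by apply: borel_compact => //; exact: compact_lcoset.
  (* By left invariance, $d_n g^L d_n^{-1}$ has the measure of $g^L d_n^{-1}$. *)
  apply: etrans (haar_lcoset haar_mu _ _) _; first exact: borel_compact.
  apply/eqP; rewrite eq_le measure_ge0 andbT leNgt; apply/negP => At0.
  have fA := haar_fin_num haar_mu cAt.
  have a0 : 0 < fine (mu (rcoset A t)) by rewrite fine_gt0// At0 -ge0_fin_numE.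
  (* If $\mu(g^L t)>0$, an index [k] above $\mu(Lt)/\mu(g^L t)$ contradicts $\mu(Lt)=k\mu(g^L N
     t)\ge k\mu(g^L t)$. *)
  have /archi_boundP : 0 <= fine (mu (rcoset L t)) / fine (mu (rcoset A t)).
    by rewrite divr_ge0// fine_ge0.
  have /existsNP[N /existsNP[k /not_implyP[nN /not_implyP[Nk]]]] :=
    unb (Num.bound (fine (mu (rcoset L t)) / fine (mu (rcoset A t)))).
  move/negP; rewrite -ltnNge -(ltr_nat R) => mk Mm.
  have [sN oN _ _] := nN.
  have fT : mu (rcoset (thicken A N) t) \is a fin_num.
    rewrite ge0_fin_numE//; apply: le_lt_trans
      (haar_compact_finite haar_mu (compact_rcoset (t := t) cL)).
    apply: le_measure; rewrite ?inE.
    - apply: borel_open; apply: open_rcoset.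
      by have [] := clopen_thicken A sN oN.
    - by apply: borel_open; exact: open_rcoset.
    - by move=> z /(thickL _ nN).
  have AT : fine (mu (rcoset A t)) <= fine (mu (rcoset (thicken A N) t)).
    apply: fine_le => //; apply: le_measure; rewrite ?inE.
    - exact: borel_compact.
    - apply: borel_open; apply: open_rcoset.
      by have [] := clopen_thicken A sN oN.
    - by move=> z; exact: (@subset_thicken _ A N sN (z * t^-1)%g).
  have := Nk t => /(congr1 fine)/= LT.
  have := lt_trans Mm mk; rewrite ltr_pdivrMr// LT ltNge => /negP; apply.
  by rewrite ler_wpM2l.
have nL : open_normal L L.
  by split=> // x y Lx Ly; apply: (LM) => //; apply: (LM) => //; exact: LV.
have [k0 k0P] := haar_thicken haar_mu sL oL cL Lg nL.
(* The set of indices is nonempty, as [L] is open and normal in itself, and bounded by [m], so it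
   has a maximum. *)
pose Q k := `[< exists2 N, open_normal L N & index N k >].
have exQ : exists k, Q k by exists k0; apply/asboolP; exists L.
have ubQ k : Q k -> (k <= m)%N by move=> /asboolP[N nN /(mP N k nN)].
have [k /asboolP[N nN Nk] kmax] := ex_maxnP exQ ubQ.
have [sN oN NL NJ] := nN.
have idx1 N' k' : index N' k' -> mu L = (k'%:R * fine (mu (thicken A N')))%:E.
  by move=> /(_ 1%g); rewrite !rcoset1.
have clN' N' : open_normal L N' -> clopen (thicken A N').
  by move=> [sN' oN' _ _]; exact: clopen_thicken.
have fN' N' : open_normal L N' -> mu (thicken A N') \is a fin_num.
  move=> nN'; rewrite ge0_fin_numE//.
  apply: le_lt_trans (haar_compact_finite haar_mu cL).
  apply: le_measure; rewrite ?inE; last exact: thickL.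
  - by apply: borel_open; have [] := clN' _ nN'.
  - exact: borel_open.
(* Maximality gives $k'\le k$, and $k'>0$ since $\mu(L)>0$. A nonempty open difference [X] would
   give $k'\mu(g^L N')<k'\mu(g^L N)\le k\mu(g^L N)$, although both ends equal $\mu(L)$. *)
have TN N' : open_normal L N' -> N' `<=` N -> thicken A N `<=` thicken A N'.
  move=> nN' N'N; have [k' Nk'] := haar_thicken haar_mu sL oL cL Lg nN'.
  have k'k : (k' <= k)%N by apply: kmax; apply/asboolP; exists N'.
  have TT : thicken A N' `<=` thicken A N by move=> z [a Aa /N'N]; exists a.
  have [oT clT] := clN' _ nN; have [oT' clT'] := clN' _ nN'.
  pose X := thicken A N `\` thicken A N'.
  have oX : open X by rewrite /X setDE; apply: openI => //; exact: closed_openC.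
  move=> z Tz; apply: contrapT => nTz.
  have X0 : (0 < mu X)%E by apply: haar_open_gt0 => //; exists z.
  have TX : mu (thicken A N) = (mu (thicken A N') + mu X)%E.
    rewrite -measureU//; [|exact: borel_open|exact: borel_open|].
      by rewrite /X setDUK.
    by rewrite /X setDIK.
  have lt : fine (mu (thicken A N')) < fine (mu (thicken A N)).
    by apply: fine_lt; rewrite ?fN'// TX lteDl// fN'.
  have k'0 : 0 < k'%:R :> R.
    rewrite lt0r ler0n andbT; apply: contraTneq muL => k'0.
    by rewrite (idx1 _ _ Nk') k'0 mul0r ltxx.
  have := idx1 _ _ Nk; rewrite (idx1 _ _ Nk') => -[]; apply/eqP.
  rewrite lt_eqF//.
  apply: (@lt_le_trans _ _ (k'%:R * fine (mu (thicken A N)))).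
    by rewrite ltr_pM2l.
  by rewrite ler_wpM2r ?ler_nat// fine_ge0.
have TA : thicken A N `<=` A.
  (* Small subgroups are taken inside [N], where [TN] applies; $g^L$ is compact, hence closed. *)
  apply: closed_thicken (compact_closed hausG cA) _ => W nW.
  have [|N' [sN' oN' N'L N'WN N'J]] :=
    @small_normal_subgroup G hausG lcG tdG L (W `&` N) sL oL cL.
    by apply: filterI => //; apply: open_nbhs_nbhs; split=> //; case: sN.
  exists N'; first by move=> x /N'WN[].
  by apply: TN => // x /N'WN[].
apply: (@open_conj_class _ _ (thicken A N)).
- by have [] := clN' _ nN.
- exists g; apply: subset_thicken => //; exists 1%g => //.
  by rewrite mul1g invg1 mulg1.
- by move=> z /TA[x _ <-]; exists x.
Qed.

End Conclusion.

Theorem corollary1p2 (G : topologicalGroupType)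
    (hausG : hausdorff_space G)
    (tdG : totally_disconnected [set: G])
    (lcG : locally_compact [set: G])
    (scG : @second_countable G)
    (g : G) (cg : compact (closure (cyclic_subgroup g))) :
  (open (conj_class g) <-> ~ meagre (conj_class g)) /\
  (forall (R : realType) (mu : {measure set (borelType G) -> \bar R}),
     is_haar mu ->
     (open (conj_class g) <-> ~ mu.-negligible (conj_class g))).
Proof.
have g0 : conj_class g !=set0 by exists (1 * g * 1^-1)%g; exists 1%g.
split; first split.
- by move=> oC; exact: open_not_meagre.
- exact: nonmeagre_open_conj_class.
move=> R mu haar_mu; split; last exact: nonnegligible_open_conj_class.
(* For (1) => (3), an open class is Borel and nonempty, hence of positive measure. *)
move=> oC /(negligibleP mu (borel_open oC)) C0.
by have := haar_open_gt0 haar_mu scG oC g0; rewrite C0 ltxx.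
Qed.
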